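(* Let $J\subset S$ be a homogeneous binomial ideal. Then $V_X(J)\cup[V(B)]$ is a submonoid of $X\cup[V(B)]$. If furthermore $PP'\notin V(B)$ for all $[P],[P']\in V_X(J)$, then $V_X(J)$ is a submonoid of $X\cup[V(B)]$. In particular, $V_X(J)\cap T_X$ is a submonoid of $T_X$ (for every homogeneous binomial ideal $J$).
   Context: Setting. $X$ is a complete simplicial toric variety over a field $\mathbb K$ given by a fan $\Sigma\subset\mathbb R^n$ with rays $\rho_1,\dots,\rho_r$ and corresponding primitive lattice generators $\mathbf v_1,\dots,\mathbf v_r\in\mathbb Z^n$. The matrix $\phi:\mathbb Z^n\to\mathbb Z^r$ has rows $\mathbf v_1,\dots,\mathbf v_r$, and there is an exact sequence $0\to\mathbb Z^n\xrightarrow{\phi}\mathbb Z^r\xrightarrow{\beta}\mathcal A\to 0$ with $\mathcal A\cong \mathrm{Cl}(X)$. The Cox ring $S=\mathbb K[x_1,\dots,x_r]$ is graded by $\mathcal A$ via $\deg x_j=\beta_j:=\beta(e_j)$; ''homogeneous'' refers to this grading. Let $\mathbf u_1,\dots,\mathbf u_n\in\mathbb Z^r$ be the columns of $\phi$, write $\mathbf t^{\mathbf u}=t_1^{u_1}\cdots t_r^{u_r}$, let $\pi:(\mathbb K^* )^r\to T_X\cong(\mathbb K^* )^n$, $\pi(\mathbf t)=(\mathbf t^{\mathbf u_1},\dots,\mathbf t^{\mathbf u_n})$, and $G=\ker\pi$. The torus $T_X$ is split and $1\to G\to(\mathbb K^* )^r\xrightarrow{\pi}T_X\to1$ is assumed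 exact, so $T_X=(\mathbb K^* )^r/G$. The irrelevant ideal is $B=\langle \prod_{\rho_i\notin\sigma}x_i : \sigma\in\Sigma\rangle$; the order of the torsion part of $\mathcal A$ is assumed coprime to the characteristic of $\mathbb K$, and points of $X$ are identified with orbits: $X=(\mathbb K^r\setminus V(B))/G$, with $[P]=G\cdot P$ (coordinatewise action). $[V(B)]$ denotes the set of orbits $[P]$ with $P\in V(B)\subset\mathbb K^r$. The product $[P]\cdot[P']:=[PP']$ (coordinatewise) makes $X\cup[V(B)]$ a monoid with identity $[1]=[1:\cdots:1]\in T_X$. A binomial is a difference $\mathbf x^{\mathbf a}-\mathbf x^{\mathbf b}$ of two monomials ($\mathbf a,\mathbf b\in\mathbb N^r$), and a binomial ideal is an ideal generated by binomials. For a homogeneous ideal $J$ of $S$, $V_X(J)=\{[P]\in X : F(P)=0\text{ for all homogeneous }F\in J\}$. *)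

(* Defs.v *)
From HB Require Import structures.
From mathcomp Require Import all_boot all_order all_algebra generic_quotient.
From mathcomp Require Import finmap boolp classical_sets functions cardinality.
From mathcomp Require Import reals.
From mathcomp Require Import mpoly.

Set Implicit Arguments.
Unset Strict Implicit.
Unset Printing Implicit Defensive.

Import Order.TTheory GRing.Theory Num.Theory.

Local Open Scope quotient_scope.
Local Open Scope classical_set_scope.
Local Open Scope ring_scope.

(* Fans in R^n, as finite sets of cones; vectors of R^n and Z^n are rows. *)

Section Fans.
Variables (R : realType) (n : nat).
Implicit Types (sigma tau : set 'rV[R]_n) (Sigma : set (set 'rV[R]_n)).

(* The cone spanned by the rows of M. *)
Definition cone m (M : 'M[R]_(m, n)) : set 'rV[R]_n :=
  [set x | exists2 c : 'rV[R]_m, (forall i, 0 <= c 0 i) & x = c *m M].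

Definition rational_polyhedral_cone sigma : Prop :=
  exists m (M : 'M[int]_(m, n)), sigma = cone (map_mx intr M).

Definition strongly_convex sigma : Prop :=
  forall x, sigma x -> sigma (- x) -> x = 0.

(* tau is cut out of sigma by a linear form u that is >= 0 on sigma. *)
Definition is_face tau sigma : Prop :=
  exists2 u : 'cV[R]_n, (forall x, sigma x -> 0 <= (x *m u) 0 0)
    & tau = [set x | sigma x /\ (x *m u) 0 0 = 0].

Definition is_fan Sigma : Prop :=
  [/\ finite_set Sigma,
      forall sigma, Sigma sigma ->
        rational_polyhedral_cone sigma /\ strongly_convex sigma,
      forall sigma tau, Sigma sigma -> is_face tau sigma -> Sigma tau
    & forall sigma tau, Sigma sigma -> Sigma tau ->
        is_face (sigma `&` tau) sigma /\ is_face (sigma `&` tau) tau].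

Definition simplicial_fan Sigma : Prop :=
  forall sigma, Sigma sigma ->
    exists m (M : 'M[R]_(m, n)), row_free M /\ sigma = cone M.

Definition complete_fan Sigma : Prop :=
  \bigcup_(sigma in Sigma) sigma = setT.

(* In particular v != 0. *)
Definition primitive (v : 'rV[int]_n) : Prop :=
  forall (k : nat) (w : 'rV[int]_n), v = w *+ k -> k = 1%N.

Definition ray_of (v : 'rV[int]_n) : set 'rV[R]_n :=
  cone (map_mx intr v).

(* Strongly convex cones of dimension one are exactly the half-lines. *)
Definition is_ray sigma : Prop :=
  exists2 x : 'rV[R]_n, x != 0 & sigma = cone x.

(* The rows of phi are the primitive generators of the rays of Sigma, each ray
   being listed exactly once. *)
Definition ray_generators Sigma r (phi : 'M[int]_(r, n)) : Prop :=
  [/\ forall i, primitive (row i phi),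
      injective (fun i => ray_of (row i phi))
    & forall rho, (Sigma rho /\ is_ray rho) <->
        exists i, rho = ray_of (row i phi)].

End Fans.
Arguments ray_of R {n} v _.

(* The sequence 0 -> Z^n -phi-> Z^r -beta-> A -> 0, on column vectors. *)
Definition class_group_exact n r (phi : 'M[int]_(r, n)) (A : zmodType)
    (beta : 'cV[int]_r -> A) : Prop :=
  [/\ injective (fun m : 'cV[int]_n => phi *m m),
      forall b, beta b = 0 <-> exists m : 'cV[int]_n, b = phi *m m
    & forall a, exists b, beta b = a].

Definition torsion_part (A : zmodType) : set A :=
  [set a | exists2 k : nat, (0 < k)%N & a *+ k = 0].

(* The torsion part is finite whenever A is finitely generated, as it is here. *)
Definition torsion_order (A : zmodType) : nat :=
  #|` fset_set (@torsion_part A)|.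

Section CoxRing.
Variables (K : fieldType) (r : nat).
Local Notation S := {mpoly K[r]}.
Implicit Types (J E : set S) (F : S).

Definition is_ideal J : Prop :=
  [/\ J 0, forall F F', J F -> J F' -> J (F + F')
    & forall F F', J F' -> J (F * F')].

Definition ideal_gen E : set S := smallest is_ideal E.

Definition zeros J : set {ffun 'I_r -> K} :=
  [set P | forall F, J F -> F.@[P] = 0].

Definition is_binomial F : Prop :=
  exists a b : 'X_{1..r}, F = 'X_[a] - 'X_[b].

Definition binomial_ideal J : Prop :=
  exists2 E : set S, (forall F, E F -> is_binomial F) & J = ideal_gen E.

Section Grading.
Variables (A : zmodType) (beta : 'cV[int]_r -> A).

Definition mdegA (m : 'X_{1..r}) : A := \sum_(j < r) beta (delta_mx j 0) *+ m j.

Definition homogeneous F : Prop :=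
  exists a : A, forall m, m \in msupp F -> mdegA m = a.

Definition hcomponent (a : A) F : S :=
  \sum_(m <- msupp F | mdegA m == a) F@_m *: 'X_[m].

Definition homogeneous_ideal J : Prop :=
  is_ideal J /\ forall F a, J F -> J (hcomponent a F).

End Grading.
End CoxRing.

Section Irrelevant.
Variables (K : fieldType) (R : realType) (n r : nat).
Variables (Sigma : set (set 'rV[R]_n)) (phi : 'M[int]_(r, n)).

Definition irrelevant_ideal : set {mpoly K[r]} :=
  ideal_gen [set F | exists2 sigma, Sigma sigma
    & F = \prod_(i < r | ~~ `[< ray_of R (row i phi) `<=` sigma >]) 'X_i].

Definition VB : set {ffun 'I_r -> K} := zeros irrelevant_ideal.

End Irrelevant.
Arguments VB {K R n r} Sigma phi _.

(* Points of K^m are finite functions, multiplied coordinatewise. *)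

Definition torus (K : fieldType) (m : nat) : set {ffun 'I_m -> K} :=
  [set t | forall i, t i != 0].
Arguments torus : clear implicits.

Section Quotient.
Variables (K : fieldType) (n r : nat) (phi : 'M[int]_(r, n)).
Local Notation pt := {ffun 'I_r -> K}.

Definition torus_map (t : pt) : {ffun 'I_n -> K} :=
  [ffun j => \prod_(i < r) t i ^ phi i j].

Definition torus_ker : set pt := [set t | torus K r t /\ torus_map t = 1].

Definition same_orbit (P Q : pt) : bool :=
  `[< exists2 t, torus_ker t & Q = t * P >].

Lemma torus_ker1 : torus_ker 1.
Proof.
split=> [i|]; first by rewrite ffunE oner_neq0.
by apply/ffunP=> j; rewrite !ffunE big1 // => i _; rewrite ffunE exp1rz.
Qed.

Lemma torus_kerM s t : torus_ker s -> torus_ker t -> torus_ker (s * t).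
Proof.
move=> [s0 s1] [t0 t1]; split=> [i|]; first by rewrite ffunE mulf_neq0.
have -> : torus_map (s * t) = torus_map s * torus_map t.
  apply/ffunP=> j; rewrite !ffunE -big_split; apply: eq_bigr => i _.
  by rewrite ffunE expfzMl.
by rewrite s1 t1 mulr1.
Qed.

Lemma torus_kerV t : torus_ker t ->
  exists2 s, torus_ker s & s * t = 1.
Proof.
move=> [t0 t1]; exists [ffun i => (t i)^-1]; last first.
  by apply/ffunP=> i; rewrite !ffunE mulVf.
split=> [i|]; first by rewrite ffunE invr_eq0.
apply/ffunP=> j; have /ffunP/(_ j) := t1; rewrite !ffunE => tj.
rewrite -[RHS]invr1 -[in RHS]tj -prodfV; apply: eq_bigr => i _.
by rewrite ffunE exprz_inv invr_expz.
Qed.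

Lemma same_orbit_refl : reflexive same_orbit.
Proof. by move=> P; apply/asboolP; exists 1; [exact: torus_ker1|rewrite mul1r]. Qed.

Lemma same_orbit_imp P Q : same_orbit P Q -> same_orbit Q P.
Proof.
move=> /asboolP[t /torus_kerV[s Gs st] ->]; apply/asboolP; exists s => //.
by rewrite mulrA st mul1r.
Qed.

Lemma same_orbit_sym : ssrbool.symmetric same_orbit.
Proof. by move=> P Q; apply/idP/idP; exact: same_orbit_imp. Qed.

Lemma same_orbit_trans : transitive same_orbit.
Proof.
move=> Q P U /asboolP[s Gs ->] /asboolP[t Gt ->]; apply/asboolP.
by exists (t * s); [exact: torus_kerM|rewrite mulrA].
Qed.

Canonical orbit_equiv :=
  EquivRel same_orbit same_orbit_refl same_orbit_sym same_orbit_trans.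

(* K^r / G, the set of all orbits; it is the disjoint union of X and [V(B)]. *)
Definition orbits : Type := {eq_quot orbit_equiv}.

HB.instance Definition _ := Choice.on orbits.
HB.instance Definition _ : EqQuotient _ orbit_equiv orbits :=
  EqQuotient.on orbits.

Definition orbit_of (P : pt) : orbits := \pi P.

Lemma orbitP P Q : orbit_of P = orbit_of Q <-> exists2 t, torus_ker t & Q = t * P.
Proof.
split=> [/eqmodP/asboolP //|h]; apply/eqmodP/asboolP; exact: h.
Qed.

Definition orbit_mul (x y : orbits) : orbits := orbit_of (repr x * repr y).

Lemma orbit_mulE P Q : orbit_mul (orbit_of P) (orbit_of Q) = orbit_of (P * Q).
Proof.
have /orbitP[s Gs Ps] : orbit_of (repr (orbit_of P)) = orbit_of P by exact: reprK.
have /orbitP[t Gt Qt] : orbit_of (repr (orbit_of Q)) = orbit_of Q by exact: reprK.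
apply/orbitP; exists (s * t); first exact: torus_kerM.
by rewrite {1}Ps {1}Qt; apply/ffunP=> i; rewrite !ffunE mulrACA.
Qed.

Lemma orbit_surj (x : orbits) : exists P, x = orbit_of P.
Proof. by exists (repr x); rewrite /orbit_of reprK. Qed.

Fact orbit_mulA : associative orbit_mul.
Proof.
move=> x y z; have [P ->] := orbit_surj x; have [Q ->] := orbit_surj y.
by have [U ->] := orbit_surj z; rewrite !orbit_mulE mulrA.
Qed.

Fact orbit_mul1 : left_id (orbit_of 1) orbit_mul.
Proof. by move=> x; have [P ->] := orbit_surj x; rewrite orbit_mulE mul1r. Qed.

Fact orbit_mulr1 : right_id (orbit_of 1) orbit_mul.
Proof. by move=> x; have [P ->] := orbit_surj x; rewrite orbit_mulE mulr1. Qed.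

HB.instance Definition _ :=
  isMonoid.Build orbits orbit_mulA orbit_mul1 orbit_mulr1.

(* T_X = (K^* )^r / G *)
Definition TX : set orbits := orbit_of @` torus K r.

End Quotient.
Arguments TX K {n r} phi _.
Arguments orbit_of {K n r} phi P.

Section Toric.
Variables (K : fieldType) (R : realType) (n r : nat).
Variables (Sigma : set (set 'rV[R]_n)) (phi : 'M[int]_(r, n)).

Definition toricX : set (orbits K phi) :=
  orbit_of phi @` ~` VB Sigma phi.

Definition orbVB : set (orbits K phi) :=
  orbit_of phi @` VB Sigma phi.

Definition VX (A : zmodType) (beta : 'cV[int]_r -> A) (J : set {mpoly K[r]}) :
    set (orbits K phi) :=
  orbit_of phi @` [set P | ~ VB Sigma phi P /\
    forall F, J F -> homogeneous beta F -> F.@[P] = 0].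

(* X `|` [V(B)] is thus the whole monoid [orbits]. *)
Lemma toricX_orbVB : toricX `|` orbVB = setT.
Proof.
apply/seteqP; split=> // x _; have [P ->] := orbit_surj x.
have [PB|PB] := pselect (VB Sigma phi P); [right|left];
  by exists P.
Qed.

End Toric.
Arguments VX {K R n r} Sigma phi {A} beta J _.
Arguments toricX K {R n r} Sigma phi _.
Arguments orbVB K {R n r} Sigma phi _.

(* N is a submonoid of M, where M is itself a submonoid of the ambient Q. *)
Definition submonoid (Q : monoidType) (N M : set Q) : Prop :=
  N `<=` M /\ monoid_closed (mem N).

Lemma TX_submonoid (K : fieldType) (n r : nat) (phi : 'M[int]_(r, n)) :
  submonoid (TX K phi) setT.
Proof.
split=> //; split.
  rewrite -topredE /= inE; exists 1 => // i; first by rewrite ffunE oner_neq0.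
move=> x y; rewrite -!topredE /= !inE => -[s s0 <-] [t t0 <-].
exists (s * t) => [i|]; first by rewrite ffunE mulf_neq0.
by rewrite -orbit_mulE.
Qed.

(* Main.v *)
Require Import Defs.
From HB Require Import structures.
From mathcomp Require Import all_boot all_order all_algebra.
From mathcomp Require Import boolp classical_sets functions cardinality reals.
From mathcomp Require Import mpoly.

Import GRing.Theory.

Local Open Scope classical_set_scope.
Local Open Scope ring_scope.

(** The membership of an orbit in V_X(J) only tests the homogeneous elements of
    J, while the binomials generating J are arbitrary.  Since J is a homogeneous
    ideal, it contains the graded components of each of its elements, so a point
    killed by the homogeneous part of J is a zero of all of J
    ([zeros_homogeneous_part]), in particular of the binomial generators.

    Monomials are multiplicative in the point: x^a(PP') = x^a(P) x^a(P').  Hence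
    x^a(P) = x^b(P) and x^a(P') = x^b(P') give x^a(PP') = x^b(PP'), and also
    x^a(1) = x^b(1), so the zeros of a binomial ideal form a multiplicative
    monoid of points ([zeros_binomial1], [zeros_binomialM]).  For the same
    reason V(B), the zero locus of a monomial ideal, absorbs products
    ([VB_mul]).  The first claim combines these two facts.

    The other two claims need the identity and the products to stay away from
    V(B).  A complete fan has a cone containing the origin, so B has at least
    one monomial generator; as it is nonzero at each point of the torus, the
    torus misses V(B) ([torus_notin_VB]).  In particular 1 is not in V(B).  For
    products, the second claim assumes what is needed, and in the third the
    points lie in the torus, because an orbit meeting it is contained in it
    ([orbit_in_TX]). *)

(** The polynomials vanishing at a point form an ideal, so it is enough to test
    generators. *)
Lemma zeros_ideal_gen {K : fieldType} {r : nat} (E : set {mpoly K[r]}) :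
  zeros (ideal_gen E) = zeros E.
Proof.
apply/seteqP; split=> P vanish F.
  by move=> EF; apply: vanish; exact: sub_gen_smallest.
move=> genF; apply: (genF [set G | G.@[P] = 0]).
split; last exact: vanish.
split=> /=.
- by rewrite meval0.
- by move=> G H G0 H0; rewrite mevalD G0 H0 addr0.
- by move=> G H H0; rewrite mevalM H0 mulr0.
Qed.

Lemma meval_monomial1 {K : fieldType} {r : nat} (m : 'X_{1..r}) :
  'X_[m].@[(1 : {ffun 'I_r -> K})] = 1.
Proof. by rewrite mevalX big1 // => i _; rewrite ffunE expr1n. Qed.

Lemma meval_monomialM {K : fieldType} {r : nat} (m : 'X_{1..r})
    (P Q : {ffun 'I_r -> K}) :
  'X_[m].@[P * Q] = 'X_[m].@[P] * 'X_[m].@[Q].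
Proof.
by rewrite !mevalX -big_split; apply: eq_bigr => i _; rewrite ffunE exprMn.
Qed.

Lemma zeros_binomial1 {K : fieldType} {r : nat} (J : set {mpoly K[r]}) :
  binomial_ideal J -> zeros J 1.
Proof.
move=> [E binE ->]; rewrite zeros_ideal_gen => F /binE[a [b ->]].
by rewrite mevalB !meval_monomial1 subrr.
Qed.

Lemma zeros_binomialM {K : fieldType} {r : nat} (J : set {mpoly K[r]})
    (P Q : {ffun 'I_r -> K}) :
  binomial_ideal J -> zeros J P -> zeros J Q -> zeros J (P * Q).
Proof.
move=> [E binE ->]; rewrite zeros_ideal_gen => P0 Q0 F EF.
have [a [b defF]] := binE F EF; move: (P0 F EF) (Q0 F EF).
rewrite {F EF}defF !mevalB => /eqP; rewrite subr_eq0 => /eqP Pab.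
move=> /eqP; rewrite subr_eq0 => /eqP Qab.
by rewrite !meval_monomialM Pab Qab subrr.
Qed.

Lemma hcomponent_homogeneous {K : fieldType} {r : nat} {A : zmodType}
    (beta : 'cV[int]_r -> A) (a : A) (F : {mpoly K[r]}) :
  homogeneous beta (hcomponent beta a F).
Proof.
exists a => m; rewrite mcoeff_msupp; apply: contraNeq => deg_m.
rewrite /hcomponent raddf_sum /= big1 // => k /eqP deg_k.
rewrite mcoeffZ mcoeffX; case: eqP => [eq_km|_]; last by rewrite mulr0.
by case/eqP: deg_m; rewrite -eq_km.
Qed.

(** Exchanging the sums, each monomial of F is counted once, for its own
    degree. *)
Lemma sum_hcomponent {K : fieldType} {r : nat} {A : zmodType}
    (beta : 'cV[int]_r -> A) (F : {mpoly K[r]}) :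
  F = \sum_(a <- undup (map (mdegA beta) (msupp F))) hcomponent beta a F.
Proof.
rewrite {1}[F]mpolyE /hcomponent; under [RHS]eq_bigr do rewrite big_mkcond.
rewrite exchange_big /= big_seq [RHS]big_seq; apply: eq_bigr => m suppm.
rewrite -big_mkcond /= (big_rem (mdegA beta m)) /=; last first.
  by rewrite mem_undup map_f.
rewrite eqxx big_seq_cond big1 ?addr0 // => a /andP[].
rewrite mem_rem_uniq ?undup_uniq // !inE => /andP[/negPf ne _].
by rewrite eq_sym ne.
Qed.

(** A homogeneous ideal contains the graded components of its elements, and
    these sum up to the element. *)
Lemma zeros_homogeneous_part {K : fieldType} {r : nat} {A : zmodType}
    (beta : 'cV[int]_r -> A) (J : set {mpoly K[r]}) :
  homogeneous_ideal beta J ->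
  zeros [set F | J F /\ homogeneous beta F] = zeros J.
Proof.
move=> [_ Jcomp]; apply/seteqP; split=> P vanish F; last first.
  by move=> [JF _]; apply: vanish.
move=> JF; rewrite (sum_hcomponent beta F) raddf_sum big1 //= => a _.
by apply: vanish; split; [exact: Jcomp | exact: hcomponent_homogeneous].
Qed.

Lemma VX_homogeneous {K : fieldType} {R : realType} {n r : nat}
    (Sigma : set (set 'rV[R]_n)) (phi : 'M[int]_(r, n)) {A : zmodType}
    (beta : 'cV[int]_r -> A) (J : set {mpoly K[r]}) :
  homogeneous_ideal beta J ->
  VX Sigma phi beta J = orbit_of phi @` (zeros J `\` VB Sigma phi).
Proof.
move=> /zeros_homogeneous_part <-; congr (_ @` _); apply/seteqP.
split=> P [] /= => [PB P0|P0 PB]; split=> // F; first by move=> []; apply: P0.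
by move=> JF hF; apply: P0.
Qed.

Lemma VB_coordinates {K : fieldType} {R : realType} {n r : nat}
    (Sigma : set (set 'rV[R]_n)) (phi : 'M[int]_(r, n))
    (P : {ffun 'I_r -> K}) :
  VB Sigma phi P <-> forall sigma, Sigma sigma ->
    \prod_(i < r | ~~ `[< ray_of R (row i phi) `<=` sigma >]) P i = 0.
Proof.
rewrite /VB zeros_ideal_gen; split=> [P0 sigma Ssigma|P0 F [sigma Ssigma ->]].
  rewrite -[RHS](P0 _ (ex_intro2 _ _ sigma Ssigma erefl)) rmorph_prod.
  by apply: eq_bigr => i _; rewrite /= mevalXU.
rewrite -[RHS](P0 _ Ssigma) rmorph_prod.
by apply: eq_bigr => i _; rewrite /= mevalXU.
Qed.

Lemma VB_mul {K : fieldType} {R : realType} {n r : nat}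
    (Sigma : set (set 'rV[R]_n)) (phi : 'M[int]_(r, n))
    (P Q : {ffun 'I_r -> K}) :
  VB Sigma phi P \/ VB Sigma phi Q -> VB Sigma phi (P * Q).
Proof.
rewrite !VB_coordinates => PQ0 sigma Ssigma; under eq_bigr do rewrite ffunE.
by rewrite big_split /=; case: PQ0 => -> //; rewrite (mul0r, mulr0).
Qed.

(** Completeness supplies a cone, and the monomial of that cone has no zero on
    the torus; for the empty fan B would be 0 and V(B) the whole space. *)
Lemma torus_notin_VB {K : fieldType} {R : realType} {n r : nat}
    (Sigma : set (set 'rV[R]_n)) (phi : 'M[int]_(r, n))
    (t : {ffun 'I_r -> K}) :
  complete_fan Sigma -> torus K r t -> ~ VB Sigma phi t.
Proof.
move=> complete t0 /VB_coordinates tB.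
have [sigma Ssigma _] : (\bigcup_(sigma in Sigma) sigma) 0 by rewrite complete.
have /eqP := tB _ Ssigma; apply/negP/prodf_neq0 => i _; exact: t0.
Qed.

Lemma torus1 {K : fieldType} {r : nat} : torus K r 1.
Proof. by move=> i; rewrite ffunE oner_neq0. Qed.

Lemma torusM {K : fieldType} {r : nat} (s t : {ffun 'I_r -> K}) :
  torus K r s -> torus K r t -> torus K r (s * t).
Proof. by move=> s0 t0 i; rewrite ffunE mulf_neq0. Qed.

Lemma orbit_in_TX {K : fieldType} {n r : nat} (phi : 'M[int]_(r, n))
    (P : {ffun 'I_r -> K}) :
  TX K phi (orbit_of phi P) <-> torus K r P.
Proof.
split=> [[t t0 /orbitP[s [s0 _] ->]] i|]; last by exists P.
by rewrite ffunE mulf_neq0.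
Qed.

(** Sets of orbits are handled through sets of representatives, where the
    product is coordinatewise. *)
Lemma submonoid_image_orbits {K : fieldType} {n r : nat}
    (phi : 'M[int]_(r, n)) (Z : set {ffun 'I_r -> K})
    (M : set (orbits K phi)) :
  Z 1 -> (forall P Q, Z P -> Z Q -> Z (P * Q)) ->
  orbit_of phi @` Z `<=` M -> submonoid (orbit_of phi @` Z) M.
Proof.
move=> Z1 ZM subM; split=> //; split; first by rewrite -topredE /= inE; exists 1.
move=> x y; rewrite -!topredE /= !inE => -[P ZP <-] [Q ZQ <-].
by exists (P * Q); [exact: ZM | rewrite -orbit_mulE].
Qed.

Theorem proposition2p1 (K : fieldType) (R : realType) (n r : nat)
    (Sigma : set (set 'rV[R]_n)) (phi : 'M[int]_(r, n))
    (A : zmodType) (beta : {additive 'cV[int]_r -> A})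
    (Sigma_fan : is_fan Sigma)
    (Sigma_simplicial : simplicial_fan Sigma)
    (Sigma_complete : complete_fan Sigma)
    (phi_rays : ray_generators Sigma phi)
    (beta_exact : class_group_exact phi beta)
    (torsion_coprime :
       forall p : nat, p \in [pchar K] -> coprime (torsion_order A) p)
    (torus_map_surj :
       set_surj (torus K r) (torus K n) (torus_map (K := K) phi))
    (J : set {mpoly K[r]})
    (J_homogeneous : homogeneous_ideal beta J)
    (J_binomial : binomial_ideal J) :
  [/\ submonoid (VX Sigma phi beta J `|` orbVB K Sigma phi)
                (toricX K Sigma phi `|` orbVB K Sigma phi),
      (forall P P' : {ffun 'I_r -> K},
         VX Sigma phi beta J (orbit_of phi P) ->
         VX Sigma phi beta J (orbit_of phi P') ->
         ~ VB Sigma phi (P * P')) ->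
      submonoid (VX Sigma phi beta J)
                (toricX K Sigma phi `|` orbVB K Sigma phi)
    & submonoid (VX Sigma phi beta J `&` TX K phi) (TX K phi)].
Proof.
have one_notin_VB : ~ VB Sigma phi (1 : {ffun 'I_r -> K}).
  exact: torus_notin_VB Sigma_complete torus1.
have one_zero : zeros J 1 by exact: zeros_binomial1.
have zeroM P Q : zeros J P -> zeros J Q -> zeros J (P * Q).
  by exact: zeros_binomialM.
rewrite VX_homogeneous //; split.
- have -> : orbit_of phi @` (zeros J `\` VB Sigma phi) `|` orbVB K Sigma phi =
      orbit_of phi @` (zeros J `|` VB Sigma phi).
    by rewrite -image_setU setDE setUIl setUC [X in _ `&` X]setUC setUv setIT.
  rewrite toricX_orbVB.
  apply: submonoid_image_orbits => //; first by left.
  move=> P Q [P0|PB]; last by move=> _; right; apply: VB_mul; left.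
  move=> [Q0|QB]; first by left; exact: zeroM.
  by right; apply: VB_mul; right.
- move=> mul_notin_VB; rewrite toricX_orbVB.
  apply: submonoid_image_orbits => // P Q ZP ZQ.
  have [[P0 _] [Q0 _]] := (ZP, ZQ).
  by split; [exact: zeroM | apply: mul_notin_VB; [exists P | exists Q]].
  (* The representative witnessing membership in V_X(J) and the one in the torus
     may differ; they are in the same orbit, so both are in the torus. *)
- have -> : orbit_of phi @` (zeros J `\` VB Sigma phi) `&` TX K phi =
      orbit_of phi @` (zeros J `&` torus K r).
    apply/seteqP; split=> [_ [[P [P0 _] <-] /orbit_in_TX tP]|_ [P [P0 tP] <-]].
      by exists P.
    split; last by exists P.
    by exists P => //; split=> //; exact: torus_notin_VB.
  apply: submonoid_image_orbits; first by split=> //; exact: torus1.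
    by move=> P Q [P0 tP] [Q0 tQ]; split; [exact: zeroM | exact: torusM].
  by move=> _ [P [_ tP] <-]; exists P.
Qed.
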